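(* Let $X$ be a space, $P$ a $\sigma$-bounded subset of $X$, $P\subset Y\subset\overline P$ (closure in $X$), and let $Z$ be a relatively countably compact subset of $C_p(X)$. Then the closure of $\pi^X_Y(Z)=\{f|_Y: f\in Z\}$ in $C_p(X|Y)$ is an Eberlein compactum.
   Context: All spaces are Tychonoff. $C_p(X)$ is the space of continuous real-valued functions on $X$ with the topology of pointwise convergence. For $Y\subset X$, $C_p(X|Y)=\{f|_Y:f\in C_p(X)\}$, with the topology of pointwise convergence on $Y$ (as a subspace of $\mathbb R^Y$), and $\pi^X_Y$ is the restriction map $f\mapsto f|_Y$. A subset of $X$ is bounded in $X$ if every continuous function $X\to\mathbb R$ is bounded on it; it is $\sigma$-bounded if it is a countable union of sets bounded in $X$. A subset $Z$ of a space $T$ is relatively countably compact in $T$ if every sequence in $Z$ has an accumulation point in $T$. An Eberlein compactum is a compact space homeomorphic to a compact subset of a Banach space in the weak topology (equivalently, to a compact subspace of $C_p(K)$ for a compact $K$). *)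

(* Defs.v *)
From HB Require Import structures.
From mathcomp Require Import all_boot all_order all_algebra.
From mathcomp Require Import all_classical all_reals all_analysis.

Set Implicit Arguments.
Unset Strict Implicit.
Unset Printing Implicit Defensive.

Import Order.TTheory GRing.Theory Num.Theory.
Export numFieldNormedType.Exports.

Local Open Scope classical_set_scope.
Local Open Scope ring_scope.

Definition tychonoff_space (X : topologicalType) : Prop :=
  hausdorff_space X /\ completely_regular_space X.

(* The spaces C_p(X) and C_p(X|Y) are given as sets of functions; the coercion
   from sets to types turns them into topological spaces, with the topology
   induced by that of pointwise convergence. *)
Definition Cp (R : realType) (X : topologicalType) : set {ptws X -> R} :=
  [set f | continuous (f : X -> R)].
Arguments Cp : clear implicits.

Definition Cp_rel (R : realType) (X : topologicalType) (Y : set X) :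
  set {ptws Y -> R} := [set sigL Y f | f in Cp R X].
Arguments Cp_rel R {X} Y _.

Definition restr_map (R : realType) (X : topologicalType) (Y : set X)
    (f : Cp R X) : Cp_rel R Y :=
  SigSub (mem_set (imageP (sigL Y) (set_valP f))).

Definition bounded_in (R : realType) (X : topologicalType) (A : set X) : Prop :=
  forall f : X -> R, continuous f -> [bounded f x | x in A].

Definition sigma_bounded (R : realType) (X : topologicalType) (P : set X) :
    Prop :=
  exists A : nat -> set X,
    (forall n, bounded_in R (A n)) /\ P = \bigcup_n A n.

(* An accumulation point of a sequence [u] is a point each neighbourhood of
   which contains [u n] for infinitely many indices [n]. *)
Definition relatively_countably_compact (T : topologicalType) (Z : set T) :
    Prop :=
  forall u : nat -> T, (forall n, Z (u n)) -> cluster (u @ \oo) !=set0.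

Definition homeomorphic (S T : topologicalType) : Prop :=
  exists (f : S -> T) (g : T -> S),
    [/\ continuous f, continuous g, cancel f g & cancel g f].

Definition cont_dual (R : realType) (E : normedModType R) : Type :=
  {phi : {linear E -> R^o} | continuous (phi : E -> R)}.

Definition cont_dual_eval (R : realType) (E : normedModType R) (x : E) :
  {ptws (cont_dual E) -> R} := fun phi => sval phi x.

(* The weak topology of [E] is the coarsest one making all elements of the
   continuous dual continuous; as such it is pulled back from R^(cont_dual E). *)
Definition weak_space (R : realType) (E : normedModType R) : topologicalType :=
  initial_topology (@cont_dual_eval R E).

Definition eberlein_compactum (R : realType) (K : topologicalType) : Prop :=
  compact [set: K] /\
  exists (E : completeNormedModType R) (A : set (weak_space E)),
    compact A /\ homeomorphic K A.

(* Main.v *)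
Require Import Defs.
From HB Require Import structures.
From mathcomp Require Import all_boot all_order all_algebra.
From mathcomp Require Import all_classical all_reals all_analysis.
From mathcomp Require Import lra.

(* Write [P] as the union of an increasing sequence of bounded sets [A n].  On
   a bounded set, countably many continuous functions only see a relatively
   compact metrizable image.  Together with relative countable compactness of
   [Z], this shows that a pointwise limit [g] of [Z] on [Y] agrees on [P] with
   all cluster points of a suitable sequence of [Z], so that [g] extends to a
   continuous function on [X]; hence the closure [K] is compact.  The map
   [g |-> (atan (g x) / (n + 1))_(n, x in A n)] embeds [K] into the Banach space
   of bounded functions on [nat * X].  It is continuous for the weak topology:
   the variation of a functional on that space is finitely additive, and a
   sequence of sets on which it is bounded below has a subsequence with the
   finite intersection property, which replaces the dominated convergence
   theorem in Grothendieck's argument. *)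

Set Implicit Arguments.
Unset Strict Implicit.
Unset Printing Implicit Defensive.

Import Order.TTheory GRing.Theory Num.Theory.

Local Open Scope classical_set_scope.
Local Open Scope ring_scope.

(** * The Banach space of bounded functions *)

Definition bounded_fun_pred (R : realType) (I : Type) : {pred I -> R^o} :=
  [pred f | `[< exists M : R, forall i, `|f i| <= M >]].
Arguments bounded_fun_pred : clear implicits.

Lemma bounded_fun_predP (R : realType) (I : Type) (f : I -> R^o) :
  reflect (exists M : R, forall i, `|f i| <= M) (f \in bounded_fun_pred R I).
Proof. exact: asboolP. Qed.

Lemma bounded_fun_submod_closed (R : realType) (I : Type) :
  submod_closed (bounded_fun_pred R I).
Proof.
split; first by apply/bounded_fun_predP; exists 0 => i; rewrite normr0.
move=> a u v /bounded_fun_predP[M uM] /bounded_fun_predP[N vN].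
apply/bounded_fun_predP; exists (`|a| * M + N) => i.
rewrite (le_trans (ler_normD _ _))// lerD// normrM ler_wpM2l//.
Qed.

HB.instance Definition _ (R : realType) (I : Type) :=
  GRing.isSubmodClosed.Build R (I -> R^o) (bounded_fun_pred R I)
    (bounded_fun_submod_closed R I).

Record bounded_fun (R : realType) (I : Type) := BoundedFun {
  bounded_fun_val :> I -> R^o;
  bounded_fun_valP : bounded_fun_val \in bounded_fun_pred R I }.

HB.instance Definition _ (R : realType) (I : Type) :=
  [isSub for @bounded_fun_val R I].
HB.instance Definition _ (R : realType) (I : Type) :=
  [Choice of bounded_fun R I by <:].
HB.instance Definition _ (R : realType) (I : Type) :=
  [SubChoice_isSubLmodule of bounded_fun R I by <:].

Section sup_norm.
Context {R : realType} {I : Type}.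
Implicit Types u v : bounded_fun R I.

(* [0] is included so that the supremum is not taken over the empty set when
   [I] is empty. *)
Definition sup_norm u : R := sup (0 |` [set `|u i| | i in setT]).

Lemma sup_norm_has_sup u : has_sup (0 |` [set `|u i| | i in setT]).
Proof.
split; first by exists 0; left.
have /bounded_fun_predP[M uM] := bounded_fun_valP u.
exists (Num.max 0 M) => _ [->|[i _ <-]]; rewrite le_max ?lexx ?uM ?orbT//.
Qed.

Lemma sup_norm_ge u i : `|u i| <= sup_norm u.
Proof. by apply: (sup_upper_bound (sup_norm_has_sup u)); right; exists i. Qed.

Lemma sup_norm_ge0 u : 0 <= sup_norm u.
Proof. by apply: (sup_upper_bound (sup_norm_has_sup u)); left. Qed.

Lemma sup_norm_le u M : 0 <= M -> (forall i, `|u i| <= M) -> sup_norm u <= M.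
Proof.
move=> M0 uM; apply: ge_sup; first exact: (sup_norm_has_sup u).1.
by move=> _ [->|[i _ <-]].
Qed.

Lemma sup_normD u v : sup_norm (u + v) <= sup_norm u + sup_norm v.
Proof.
apply: sup_norm_le; first by rewrite addr_ge0 ?sup_norm_ge0.
by move=> i; rewrite (le_trans (ler_normD _ _))// lerD ?sup_norm_ge.
Qed.

Lemma sup_normZ (a : R) u : sup_norm (a *: u) = `|a| * sup_norm u.
Proof.
have le_normZ b w : sup_norm (b *: w) <= `|b| * sup_norm w.
  apply: sup_norm_le; first by rewrite mulr_ge0 ?sup_norm_ge0.
  by move=> i; rewrite normrM ler_wpM2l ?sup_norm_ge.
apply/eqP; rewrite eq_le le_normZ /=.
have [->|a0] := eqVneq a 0; first by rewrite normr0 mul0r sup_norm_ge0.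
rewrite -ler_pdivlMl ?normr_gt0// -normfV.
by rewrite -{1}(scalerK a0 u) le_normZ.
Qed.

Lemma sup_norm_eq0 u : sup_norm u = 0 -> u = 0.
Proof.
move=> u0; apply/val_inj/funext => i.
by apply/normr0_eq0/eqP; rewrite eq_le normr_ge0 -u0 sup_norm_ge.
Qed.

End sup_norm.

HB.instance Definition _ (R : realType) (I : Type) :=
  Lmodule_isNormed.Build R (bounded_fun R I)
    sup_normD sup_normZ sup_norm_eq0.

Lemma bounded_fun_complete (R : realType) (I : Type)
    (F : set_system (bounded_fun R I)) :
  ProperFilter F -> cauchy F -> cvg F.
Proof.
move=> PF Fc.
have Fball (e : R) : 0 < e -> exists u : bounded_fun R I, F (ball u e).
  by move=> e0; exact: ((cauchyP F).1 Fc e e0).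
pose ev i := fun u : bounded_fun R I => (u i : R).
have evc i : cvg (ev i @ F).
  apply: cauchy_cvg; apply/(cauchyP (ev i @ F)) => e e0.
  have [u Fu] := Fball e e0; exists (u i); rewrite /= nbhs_simpl/=.
  apply: filterS Fu => v; rewrite -!ball_normE/=; apply: le_lt_trans.
  exact: (sup_norm_ge (u - v) i).
pose g i : R^o := lim (ev i @ F).
(* A ball belonging to [F] gives a bound uniform in [i] that survives the passage to the pointwise
   limit. *)
have gclose u e i : F (ball u e) -> `|u i - g i| <= e.
  move=> Fu.
  have evuc : (fun v : bounded_fun R I => `|u i - v i|) @ F --> `|u i - g i|.
    by apply: cvg_norm; apply: cvgB; [exact: cvg_cst|exact: evc].
  rewrite -(cvg_lim _ evuc)//; apply: limr_le.
    by apply/cvg_ex; exists `|u i - g i|.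
  apply: filterS Fu => v; rewrite -!ball_normE/= => /ltW; apply: le_trans.
  exact: (sup_norm_ge (u - v) i).
have gP : g \in bounded_fun_pred R I.
  have [u Fu] := Fball 1 ltr01.
  apply/bounded_fun_predP; exists (1 + sup_norm u) => i.
  rewrite -[g i](subrK (u i)) (le_trans (ler_normD _ _))// lerD ?sup_norm_ge//.
  by rewrite distrC gclose.
apply/cvg_ex; exists (BoundedFun gP); apply/cvgrPdist_le => e e0.
have e20 : 0 < e / 2 by rewrite divr_gt0.
have [u Fu] := Fball (e / 2) e20.
near=> v; apply: sup_norm_le => [|i]; first exact: ltW.
have -> : (BoundedFun gP - v) i = (g i - u i) + (u i - v i) by rewrite addrA subrK.
rewrite (le_trans (ler_normD _ _))// (splitr e) lerD//; first by rewrite distrC gclose.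
rewrite (le_trans (sup_norm_ge (u - v) i))// ltW//.
by near: v; apply: filterS Fu => v; rewrite -ball_normE.
Unshelve. all: by end_near. Qed.

HB.instance Definition _ (R : realType) (I : Type) :=
  Uniform_isComplete.Build (bounded_fun R I) (@bounded_fun_complete R I).

(** * Finitely additive set functions and functionals *)

Section finitely_additive.
Context {R : realType} {I : Type} (mu : set I -> R) (M : R).
Hypothesis mu_ge0 : forall A, 0 <= mu A.
Hypothesis mu_le : forall A, mu A <= M.
Hypothesis muU : forall A B, A `&` B = set0 -> mu (A `|` B) = mu A + mu B.

Let mu0 : mu set0 = 0.
Proof. by have := muU (setI0 set0); rewrite setU0; lra. Qed.

Let mu_mono A B : A `<=` B -> mu A <= mu B.
Proof.
move=> AB; rewrite -(setDUK AB) muU ?setDIK// ?lerDl//.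
Qed.

Let muUle A B : mu (A `|` B) <= mu A + mu B.
Proof.
have -> : A `|` B = A `|` (B `\` A) by rewrite setUDr setDv setD0.
by rewrite muU ?setDIK// lerD2l mu_mono// => ? [].
Qed.

Variable B : nat -> set I.

Let thick (C : set I) :=
  exists2 e : R, 0 < e & forall N, exists2 n, (N <= n)%N & e <= mu (C `&` B n).

Let negligible (V : set I) :=
  forall e : R, 0 < e -> exists N, forall n, (N <= n)%N -> mu (V `&` B n) < e.

(* Otherwise finite unions of the sets [C `&` B n] would have vanishing overlap
   with the later ones, hence arbitrarily large measure. *)
Let thick_step C N : thick C -> exists2 n, (N <= n)%N & thick (C `&` B n).
Proof.
move=> [e e0 Ce]; apply: contrapT => nthick.
have negl n : (N <= n)%N -> negligible (C `&` B n).
  move=> Nn d d0; apply: contrapT => nd; apply: nthick; exists n => //.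
  exists d => // N'; apply: contrapT => nd'; apply: nd; exists N' => m N'm.
  by rewrite ltNge; apply/negP => dm; apply: nd'; exists m.
have large k : exists2 V, negligible V & k%:R * (e / 2) <= mu V.
  elim: k => [|k [V Vnegl kV]].
    exists set0; last by rewrite mul0r.
    by move=> d d0; exists 0%N => n _; rewrite set0I mu0.
  have e2 : 0 < e / 2 by rewrite divr_gt0.
  have [N' VN'] := Vnegl _ e2.
  have [n nN' en] := Ce (maxn N N').
  move: nN'; rewrite geq_max => /andP[Nn N'n].
  exists (V `|` (C `&` B n)).
    move=> d d0; have d2 : 0 < d / 2 by rewrite divr_gt0.
    have [N1 V1] := Vnegl _ d2; have [N2 V2] := negl n Nn _ d2.
    exists (maxn N1 N2) => m; rewrite geq_max => /andP[N1m N2m].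
    rewrite setIUl (le_lt_trans (muUle _ _))// (splitr d).
    by rewrite ltrD ?V1 ?V2.
  (* [W] has mass at least [e], less than [e / 2] of which lies in [V], so adding [W] gains at least
     [e / 2]. *)
  set W := C `&` B n.
  have -> : V `|` W = V `|` (W `\` V) by rewrite setUDr setDv setD0.
  rewrite muU ?setDIK//.
  have WE : mu W = mu (W `&` V) + mu (W `\` V).
    by rewrite -muU ?setUIDK// setDE setIACA setICr setI0.
  have WV : mu (W `&` V) < e / 2.
    by apply: le_lt_trans (VN' n N'n); apply: mu_mono => i [[]].
  by move: en; rewrite -/W WE mulrSr mulrDl mul1r; lra.
have [k Mk] : exists k, M < k%:R * (e / 2).
  exists (Num.trunc (M / (e / 2))).+1.
  by rewrite -ltr_pdivrMr ?divr_gt0// truncnS_gt.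
have [V _ kV] := large k; have := mu_le V; lra.
Qed.

(** The sets are picked one at a time by [thick_step], the running intersection staying thick; a
    thick set is nonempty because [mu set0] is 0. *)
Lemma finitely_additive_intersections (e : R) : 0 < e ->
    (forall n, e <= mu (B n)) ->
  exists s : nat -> nat, (forall n, n <= s n)%N /\
    forall k, exists i, forall j, (j <= k)%N -> B (s j) i.
Proof.
move=> e0 eB.
(* The premise [thick p.2] makes the relation total, as dependent choice demands; it is discharged
   along the sequence by [tf]. *)
pose next (p q : nat * set I) := thick p.2 ->
  [/\ thick q.2, (p.1 < q.1)%N & q.2 = p.2 `&` B q.1].
have nextP p : {q | next p q}.
  apply: cid; have [tp|ntp] := pselect (thick p.2); last by exists p.
  have [n pn tn] := thick_step p.1.+1 tp.
  by exists (n, p.2 `&` B n).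
have [f [f0 fS]] := dependent_choice nextP (0%N, setT).
have thick0 : thick setT by exists e => // N; exists N => //; rewrite setTI.
have tf k : thick (f k).2.
  by elim: k => [|k /(fS k)[]//]; rewrite f0.
have fn k : (k <= (f k).1)%N.
  by elim: k => // k ih; have [_ + _] := fS k (tf k); exact: leq_ltn_trans.
(* Stage 0 is the dummy pair [(0, setT)], so the first index really chosen is that of stage 1. *)
exists (fun k => (f k.+1).1); split=> [n|k]; first exact: ltnW (fn n.+1).
have [d d0 /(_ 0%N)[n _ dn]] := tf k.+1.
have [i fi] : (f k.+1).2 !=set0.
  apply/set0P/negP => /eqP fk0; move: dn; rewrite fk0 set0I mu0.
  by rewrite leNgt d0.
exists i => j; elim: k i fi {dn} => [|k ih] i.
  by have [_ _ ->] := fS 0%N (tf 0%N); rewrite leqn0 => -[_ ?] /eqP ->.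
have [_ _ fE] := fS k.+1 (tf k.+1).
rewrite {1}fE => -[fk Bi]; rewrite leq_eqVlt => /orP[/eqP->//|].
by rewrite ltnS; exact: ih.
Qed.

End finitely_additive.

Section functional_variation.
Context {R : realType} {I : Type}.
Variable phi : {linear bounded_fun R I -> R^o}.
Implicit Types (u v : bounded_fun R I) (A B : set I).

Lemma bounded_fun_addE u v i : (u + v) i = u i + v i :> R.
Proof. by []. Qed.

Lemma bounded_fun_scaleE (a : R) u i : (a *: u) i = a * u i :> R.
Proof. by []. Qed.

Lemma bounded_fun_ext u v : (forall i, u i = v i) -> u = v.
Proof. by move=> uv; exact/val_inj/funext. Qed.

Lemma restrict_bounded_fun_proof u A :
  ((u : I -> R^o) \_ A : I -> R^o) \in bounded_fun_pred R I.
Proof.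
apply/bounded_fun_predP; exists `|u| => i; rewrite patchE.
by case: ifP => _; [exact: sup_norm_ge|rewrite normr0].
Qed.

Definition restrict_bounded_fun u A : bounded_fun R I :=
  BoundedFun (restrict_bounded_fun_proof u A).

Let unit_on A : set (bounded_fun R I) :=
  [set u | (forall i, `|u i| <= 1) /\ forall i, ~ A i -> u i = 0].

(** This is the total variation of the finitely additive signed measure representing [phi]. No
    absolute value appears because [unit_on A] is symmetric. *)
Definition functional_variation A : R := sup [set phi u | u in unit_on A].

Variable C : R.
Hypothesis phi_le : forall u, `|phi u| <= C * `|u|.
Hypothesis C0 : 0 <= C.

Let unit_on0 A : unit_on A 0.
Proof. by split=> i // ; rewrite normr0. Qed.

Let functional_variation_has_sup A : has_sup [set phi u | u in unit_on A].
Proof.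
split; first by exists (phi 0), 0.
exists C => _ [u [u1 _] <-]; rewrite (le_trans (ler_norm _))//.
rewrite (le_trans (phi_le u))// -[leRHS]mulr1 ler_wpM2l//.
exact: sup_norm_le.
Qed.

Let functional_variation_ge A u : unit_on A u -> phi u <= functional_variation A.
Proof. by move=> Au; apply: sup_upper_bound => //; exists u. Qed.

Let functional_variation_lub A M : (forall u, unit_on A u -> phi u <= M) ->
  functional_variation A <= M.
Proof.
move=> AM; apply: ge_sup; first exact: (functional_variation_has_sup A).1.
by move=> _ [u Au <-]; exact: AM.
Qed.

Lemma functional_variation_ge0 A : 0 <= functional_variation A.
Proof. by rewrite -(linear0 phi) functional_variation_ge. Qed.

Lemma functional_variation_le A : functional_variation A <= C.
Proof.
apply: functional_variation_lub => u [u1 _]; rewrite (le_trans (ler_norm _))//.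
by rewrite (le_trans (phi_le u))// -[leRHS]mulr1 ler_wpM2l// sup_norm_le.
Qed.

(** A function supported on the union splits into its two restrictions; conversely, functions of sup
    norm at most 1 with disjoint supports have a sum of sup norm at most 1. *)
Lemma functional_variationU A B : A `&` B = set0 ->
  functional_variation (A `|` B) = functional_variation A + functional_variation B.
Proof.
move=> AB0; apply/eqP; rewrite eq_le; apply/andP; split.
  apply: functional_variation_lub => u [u1 uAB].
  have -> : u = restrict_bounded_fun u A + restrict_bounded_fun u B.
    apply: bounded_fun_ext => i; rewrite bounded_fun_addE /= !patchE.
    case: ifPn => [/set_mem Ai|/negP nAi]; case: ifPn => [/set_mem Bi|/negP nBi].
    - by have : (A `&` B) i by []; rewrite AB0.
    - by rewrite addr0.
    - by rewrite add0r.
    - by rewrite addr0 uAB// => -[Ai|Bi]; [apply: nAi|apply: nBi]; exact: mem_set.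
  rewrite linearD lerD// functional_variation_ge//; split=> i /=; rewrite patchE.
  - by case: ifP; rewrite ?normr0.
  - by case: ifPn => // /set_mem.
  - by case: ifP; rewrite ?normr0.
  - by case: ifPn => // /set_mem.
rewrite -lerBrDr; apply: functional_variation_lub => u [u1 uA].
rewrite lerBrDr addrC -lerBrDr; apply: functional_variation_lub => v [v1 vB].
rewrite lerBrDr -linearD functional_variation_ge//; split=> i.
  rewrite bounded_fun_addE; have [Ai|/uA->] := pselect (A i); last by rewrite addr0.
  rewrite vB ?add0r// => Bi.
  by have : (A `&` B) i by []; rewrite AB0.
by move=> nAB; rewrite bounded_fun_addE uA ?vB ?addr0//;
  [move=> Bi|move=> Ai]; apply: nAB; [right|left].
Qed.

(** Split [u] into its restrictions to [A] and to the complement. With [A] the set where [u] exceeds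
    [e], a large value of [phi u] forces a large variation on [A]. *)
Lemma le_functional_variation u A (M e : R) : 0 < M -> (forall i, `|u i| <= M) ->
    (forall i, ~ A i -> `|u i| <= e) -> 0 <= e ->
  `|phi u| <= M * functional_variation A + C * e.
Proof.
move=> M0 uM ue e0.
have -> : u = restrict_bounded_fun u A + restrict_bounded_fun u (~` A).
  apply: bounded_fun_ext => i; rewrite bounded_fun_addE /= !patchE in_setC.
  by case: ifP; rewrite ?addr0 ?add0r.
rewrite linearD (le_trans (ler_normD _ _))// lerD//; last first.
  rewrite (le_trans (phi_le _))// ler_wpM2l//; apply: sup_norm_le => // i /=.
  by rewrite patchE; case: ifPn => [/set_mem/ue//|_]; rewrite normr0.
have normM (t : bounded_fun R I) : (forall i, `|t i| <= M) ->
    phi (restrict_bounded_fun t A) <= M * functional_variation A.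
  move=> tM; rewrite -ler_pdivrMl//.
  have -> : M^-1 * phi (restrict_bounded_fun t A) =
      phi (M^-1 *: restrict_bounded_fun t A) by rewrite linearZ.
  apply: functional_variation_ge; split=> i; rewrite bounded_fun_scaleE /= patchE.
    rewrite normrM normfV (gtr0_norm M0) ler_pdivrMl// mulr1.
    by case: ifP => _; [exact: tM|rewrite normr0 ltW].
  by case: ifPn => [/set_mem//|]; rewrite mulr0.
have restrictN : - restrict_bounded_fun u A = restrict_bounded_fun (- u) A.
  apply: bounded_fun_ext => i; rewrite -scaleN1r bounded_fun_scaleE mulN1r /=.
  by rewrite !patchE; case: ifP; rewrite ?oppr0.
rewrite ler_norml lerNl -linearN restrictN !normM// => i.
by rewrite -scaleN1r bounded_fun_scaleE mulN1r normrN.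
Qed.

End functional_variation.

(** * Sequences of continuous functions on bounded sets *)

Lemma ultra_bounded_cvg (R : realType) (T : Type) (U : set_system T)
    (f : T -> R) (a b : R) :
  UltraFilter U -> (\forall t \near U, a <= f t <= b) -> cvg (f @ U).
Proof.
move=> UU fab.
have fUU : UltraFilter (f @ U).
  split=> [|G PG fUG]; first exact: fmap_proper_filter.
  rewrite eqEsubset; split=> // B GB; rewrite /= nbhs_simpl/=.
  have [//|UnB] := in_ultra_setVsetC (f @^-1` B) UU.
  have /fUG GnB : (f @ U) (~` B) by [].
  have /filter_ex[y [By]] : G (B `&` ~` B) by exact: filterI.
  by [].
have := @segment_compact R a b; rewrite compact_ultra => /(_ (f @ U)).
by case=> [//|l [_ fl]]; apply/cvg_ex; exists l.
Qed.

(* A bounded set is relatively compact for the topology induced by countably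
   many continuous functions. *)
Lemma bounded_in_ultra_cvg (R : realType) (X : topologicalType) (A : set X)
    (x : nat -> X) (phi : nat -> X -> R) (U : set_system nat) :
    bounded_in R A -> (forall k, A (x k)) -> (forall n, continuous (phi n)) ->
    UltraFilter U ->
  exists z, forall n, phi n (x k) @[k --> U] --> phi n z.
Proof.
move=> bA Ax phic UU.
have cvg_phi n : cvg (phi n (x k) @[k --> U]).
  have [M [_ phiM]] := bA _ (phic n).
  apply: (@ultra_bounded_cvg _ _ _ _ (- (M + 1)) (M + 1)).
  by apply: nearW => k; rewrite -ler_norml phiM ?ltrDl//.
pose c n := lim (phi n (x k) @[k --> U]).
suff [z zc] : exists z, forall n, phi n z = c n.
  by exists z => n; rewrite zc; exact: cvg_phi.
apply: contrapT => nz.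
(* The supremum [d] of the [g n] measures the distance to the missing point of values [c]. The caps
   [1 / (n + 1)] make [d] continuous; it is positive by [nz] but tends to 0 along [U], so its
   inverse is continuous and unbounded on [A]. *)
pose g n (z : X) := Num.min (n.+1%:R^-1 : R) `|phi n z - c n|.
have g0 n z : 0 <= g n z by rewrite le_min invr_ge0 ler0n normr_ge0.
have gle n z : g n z <= n.+1%:R^-1 by rewrite ge_min lexx.
pose d z := sup [set g n z | n in setT].
have has_supg z : has_sup [set g n z | n in setT].
  split; first by exists (g 0%N z), 0%N.
  by exists 1 => _ [n _ <-]; rewrite (le_trans (gle n z))// invf_le1 ?ler1n.
have dge n z : g n z <= d z by apply: (sup_upper_bound (has_supg z)); exists n.
have dle z e : (forall n, g n z <= e) -> d z <= e.
  by move=> ge; apply: ge_sup => [|_ [n _ <-]//]; exact: (has_supg z).1.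
have d_gt0 z : 0 < d z.
  rewrite ltNge; apply/negP => d0; apply: nz; exists z => n.
  have : g n z <= 0 by exact: le_trans d0.
  rewrite ge_min leNgt invr_gt0 ltr0n /= normr_le0 subr_eq0 => /eqP//.
have gc n : continuous (g n).
  move=> z; apply: (@continuous_min R X (fun=> n.+1%:R^-1)).
    exact: cvg_cst.
  by apply: cvg_norm; apply: cvgB; [exact: phic|exact: cvg_cst].
(* Only the indices below [N] need attention, the caps handling the others. The filter is arbitrary,
   to serve both for neighbourhoods of a point and for [U]. *)
have near_dle (T : Type) (F : set_system T) (y : T -> X) (e : R) : Filter F ->
    0 < e -> (forall n, \forall t \near F, g n (y t) <= e) ->
    \forall t \near F, d (y t) <= e.
  move=> FF e0 ge.
  have [N _ /(_ N (leqnn N)) Ne] := near_infty_natSinv_lt (PosNum e0).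
  have {}ge : \forall t \near F, forall n, (n < N)%N -> g n (y t) <= e.
    elim: N {Ne} => [|m ih]; first by apply: nearW.
    near=> t => n; rewrite ltnS leq_eqVlt => /orP[/eqP->|].
      by near: t; exact: ge.
    by move: n; near: t.
  apply: filterS ge => t ge; apply: dle => n.
  have [/ge//|Nn] := ltnP n N.
  rewrite (le_trans (gle n _))// (le_trans _ (ltW Ne))//.
  by rewrite lef_pV2 ?posrE// ler_nat.
have dc : continuous d.
  move=> z; apply/cvgrPdist_le => e e0.
  have e20 : 0 < e / 2 by rewrite divr_gt0.
  have lower : \forall t \near z, d z - e <= d t.
    have [_ [n _ <-] dn] := sup_adherent e20 (has_supg z).
    have /cvgrPdist_le/(_ _ e20) := gc n z.
    apply: filterS => t; rewrite ler_distlC => /andP[gt _].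
    apply: le_trans (dge n t); move: dn gt; rewrite -/(d z); lra.
  have upper : \forall t \near z, d t <= d z + e.
    apply: near_dle => [|n]; first by rewrite addr_gt0.
    have /cvgrPdist_le/(_ _ e0) := gc n z.
    apply: filterS => t; rewrite ler_distlC => /andP[_ gt].
    by rewrite (le_trans gt)// lerD2r.
  by near=> t; rewrite ler_distlC; apply/andP; split; near: t.
have d1c : continuous (fun z => (d z)^-1).
  by move=> z; apply: cvgV; [rewrite gt_eqF|exact: dc].
have [M [_ dM]] := bA _ d1c.
pose M1 := Num.max (M + 1) 1.
have M1_gt0 : 0 < M1 by rewrite lt_max ltr01 orbT.
have M_lt : M < M1 by rewrite lt_max ltrDl ltr01.
have d_ge k : M1^-1 <= d (x k).
  have := dM M1 M_lt _ (Ax k).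
  rewrite /= normfV (gtr0_norm (d_gt0 _)) => dM1.
  by rewrite -(invrK (d _)) lef_pV2// posrE invr_gt0.
have e0 : 0 < M1^-1 / 2 by rewrite divr_gt0// invr_gt0.
suff : \forall k \near U, d (x k) <= M1^-1 / 2.
  move=> /filter_ex[k]; have := d_ge k; have : 0 < M1^-1 by rewrite invr_gt0.
  by lra.
apply: near_dle => // n.
have /cvgrPdist_le/(_ _ e0) : phi n (x k) @[k --> U] --> c n by exact: cvg_phi.
by apply: filterS => k; rewrite distrC => phik; rewrite ge_min phik orbT.
Unshelve. all: by end_near. Qed.

(** By induction on [n]: slice [A] into finitely many cells on which [v n] varies by less than [e],
    and take a net for the earlier functions inside each cell. *)
Lemma finite_net (R : realType) (X : choiceType) (A : set X)
    (v : nat -> X -> R) (M e : R) (n : nat) :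
    0 < e -> (forall i x, `|v i x| <= M) ->
  exists s : seq X, (forall y, y \in s -> A y) /\
    forall x, A x -> exists2 y, y \in s &
      forall i, (i < n)%N -> `|v i y - v i x| < e.
Proof.
move=> e0 vM; elim: n A => [|n IH] A.
  have [[a Aa]|nA] := pselect (exists a, A a).
    exists [:: a]; split=> [y|x _]; first by rewrite inE => /eqP->.
    by exists a; rewrite ?inE.
  by exists [::]; split=> // x Ax; case: nA; exists x.
(* Adding [M] makes the quotient nonnegative, so that truncation is the floor. *)
pose cell x := Num.trunc ((v n x + M) / e).
have vM0 x : 0 <= (v n x + M) / e.
  rewrite divr_ge0 ?(ltW e0)// -lerBlDr sub0r.
  by have := vM n x; rewrite ler_norml => /andP[].
pose L := Num.trunc ((M + M) / e).
have cellL x : (cell x <= L)%N.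
  apply: le_truncn; rewrite ler_pM2r ?invr_gt0// lerD2r.
  by rewrite (le_trans (ler_norm _)).
have [s sP] := choice (fun m => IH (A `&` [set x | cell x = m])).
exists (flatten [seq s m | m <- iota 0 L.+1]); split=> [y|x Ax].
  by move=> /flattenP[_ /mapP[m _ ->]] /(sP m).1[].
have [|y ys yx] := (sP (cell x)).2 x; first by [].
exists y => [|i].
  apply/flattenP; exists (s (cell x)) => //; apply/mapP; exists (cell x) => //.
  by rewrite mem_iota add0n ltnS cellL.
rewrite ltnS leq_eqVlt => /orP[/eqP->|]; last exact: yx.
have [_ yxc] := (sP _).1 y ys.
have /andP[xl xr] := truncn_itv (vM0 x); have /andP[yl yr] := truncn_itv (vM0 y).
move: yl yr xl xr; rewrite -/(cell x) -/(cell y) yxc.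
rewrite ler_pdivlMr// ltr_pdivrMr// ler_pdivlMr// ltr_pdivrMr// -!natr1 !mulrDl mul1r.
by move=> *; rewrite ltr_norml; apply/andP; split; lra.
Qed.

Lemma atan_inj (R : realType) : injective (@atan R).
Proof. exact: can_inj (@atanK R). Qed.

Lemma normr_atan_le2 (R : realType) (x : R) : `|atan x| <= 2.
Proof.
rewrite ler_norml; have := atan_gtNpi2 x; have := atan_ltpi2 x.
by have := pihalf_lt2 R; move=> *; apply/andP; split; lra.
Qed.

(* Only pairs of points matter in what follows: a relation between the values
   at two points that holds for all [u n] is inherited by [f]. *)
Definition pairwise_cluster (R : realType) (X : Type) (u : nat -> X -> R)
    (f : X -> R) : Prop :=
  forall x z (e : R) N, 0 < e ->
    exists n, [/\ (N <= n)%N, `|u n x - f x| < e & `|u n z - f z| < e].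

(** This is membership of [g] restricted to [Q] in the closure, in the product [R^Q], of the
    restrictions of [D]. *)
Definition adherent_on (R : realType) (X : choiceType) (D : set (X -> R))
    (Q : set X) (g : X -> R) : Prop :=
  forall (s : seq X) (e : R), (forall x, x \in s -> Q x) -> 0 < e ->
    exists2 f, D f & forall x, x \in s -> `|f x - g x| < e.

Lemma eq_of_close (R : realType) (a b : R) :
  (forall e : R, 0 < e -> `|a - b| <= e) -> a = b.
Proof.
move=> ab; apply/eqP; rewrite -subr_eq0 -normr_le0; apply/ler_addgt0Pr => e e0.
by rewrite add0r; exact: ab.
Qed.

Section interpolating_sequence.
Context {R : realType} {X : topologicalType}.
Variables (A : nat -> set X) (D : set (X -> R)) (g : X -> R).
Hypothesis bA : forall j, bounded_in R (A j).
Hypothesis Dc : forall f, D f -> continuous f.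
Hypothesis Dg : adherent_on D (\bigcup_j A j) g.

(** Index 0 of [g :: fs] is [g] itself. Composing with [atan] bounds all these functions, so that
    finite nets exist. *)
Let is_net (fs : seq (X -> R)) (s : seq X) :=
  forall j x, (j <= size fs)%N -> A j x -> exists2 y, y \in s & A j y /\
    forall i, (i < (size fs).+1)%N ->
    `|atan (nth g (g :: fs) i y) - atan (nth g (g :: fs) i x)|
      < (size fs).+1%:R^-1.

Let net_ex fs : exists s, (forall y, y \in s -> (\bigcup_j A j) y) /\ is_net fs s.
Proof.
pose k := size fs; pose v i := atan \o nth g (g :: fs) i.
suff /(_ k.+1)[s [sQ sN]] : forall m, exists s : seq X,
    (forall y, y \in s -> (\bigcup_j A j) y) /\
    forall j x, (j < m)%N -> A j x -> exists2 y, y \in s & A j y /\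
      forall i, (i < k.+1)%N -> `|v i y - v i x| < k.+1%:R^-1.
  by exists s.
elim=> [|m [s [sQ sN]]]; first by exists [::].
have k0 : 0 < k.+1%:R^-1 :> R by rewrite invr_gt0.
have [s' [s'A s'N]] := finite_net (A m) k.+1 k0
  (fun i x => normr_atan_le2 (nth g (g :: fs) i x)).
exists (s' ++ s); split=> [y|j x].
  by rewrite mem_cat => /orP[/s'A|/sQ//]; exists m.
rewrite ltnS leq_eqVlt => /orP[/eqP-> /s'N[y ys yx]|jm /(sN j x jm)[y ys yx]].
  by exists y; rewrite ?mem_cat ?ys//; split => //; exact: s'A.
by exists y; rewrite // mem_cat ys orbT.
Qed.

(** A stage stores the points and functions chosen so far: first points forming a net for [g] and
    the old functions, then a function close to [g] at all points. The premise keeps the relation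
    total. *)
Let step (p q : seq X * seq (X -> R)) :=
  (forall y, y \in p.1 -> (\bigcup_j A j) y) ->
  [/\ forall y, y \in q.1 -> (\bigcup_j A j) y,
      {subset p.1 <= q.1},
      is_net p.2 q.1 &
      exists f, [/\ D f, q.2 = rcons p.2 f &
        forall y, y \in q.1 -> `|f y - g y| < (size p.2).+1%:R^-1]].

(** A cluster function [f] equals [g] at all net points. For [x] in [A j], net points of [A j]
    approximating [x] yield a point [z], possibly outside [A j], with [f z = g x] and
    [u i z = u i x] for all [i]; clustering at the pair [x], [z] gives [f x = f z]. *)
Lemma interpolating_sequence : exists u : nat -> X -> R,
  (forall n, D (u n)) /\
  forall f, continuous f -> pairwise_cluster u f ->
    forall x, (\bigcup_j A j) x -> f x = g x.
Proof.
have stepP p : {q | step p q}.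
  apply: cid; have [pQ|npQ] := pselect (forall y, y \in p.1 -> (\bigcup_j A j) y);
    last by exists p => /npQ.
  have [s [sQ sN]] := net_ex p.2.
  have sQ' y : y \in p.1 ++ s -> (\bigcup_j A j) y.
    by rewrite mem_cat => /orP[/pQ|/sQ].
  have [|f Df fg] := Dg (e := (size p.2).+1%:R^-1) sQ'.
    by rewrite invr_gt0.
  exists (p.1 ++ s, rcons p.2 f) => _; split=> //=.
  - by move=> y yp; rewrite mem_cat yp.
  - move=> j x jp Ax; have [y ys yP] := sN j x jp Ax.
    by exists y => //; rewrite mem_cat ys orbT.
  - by exists f.
have [st [st0 stS]] := dependent_choice stepP ([::], [::]).
have stQ k y : y \in (st k).1 -> (\bigcup_j A j) y.
  elim: k y => [|k ih] y; first by rewrite st0.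
  by have [+ _ _ _] := stS k ih; exact.
have {}stS k := stS k (@stQ k).
have size_st k : size (st k).2 = k.
  elim: k => [|k ih]; first by rewrite st0.
  by have [_ _ _ [f [_ -> _]]] := stS k; rewrite size_rcons ih.
pose u k := nth g (st k.+1).2 k.
have uS k : D (u k) /\ forall y, y \in (st k.+1).1 -> `|u k y - g y| < k.+1%:R^-1.
  have [_ _ _ [f [Df stE fg]]] := stS k.
  rewrite /u stE nth_rcons size_st ltnn eqxx; split=> // y.
  by have := fg y; rewrite size_st; exact.
have st_mono k m : (k <= m)%N -> {subset (st k).1 <= (st m).1}.
  move=> /subnK <-; elim: (m - k)%N => [//|i ih] y yk.
  by have [_ + _ _] := stS (i + k)%N; apply; exact: ih.
have nth_st i k : (i < k)%N -> nth g (st k).2 i = u i.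
  elim: k => // k ih; rewrite ltnS leq_eqVlt => /orP[/eqP->//|ik].
  have [_ _ _ [f [_ -> _]]] := stS k.
  by rewrite nth_rcons size_st ik ih.
exists u; split=> [n|f fc uf x [j _ Ax]]; first exact: (uS n).1.
have fg k y : y \in (st k).1 -> f y = g y.
  move=> yk; apply: eq_of_close => e e0.
  have e20 : 0 < e / 2 by rewrite divr_gt0.
  have [N _ /(_ _ (leqnn N)) /= Ne] := near_infty_natSinv_lt (PosNum e20).
  have [n [kn un _]] := uf y y (e / 2) (maxn k N) e20.
  move: kn; rewrite geq_max => /andP[kn Nn].
  have ung := (uS n).2 y (@st_mono k n.+1 (leqW kn) y yk).
  have nN : n.+1%:R^-1 <= N.+1%:R^-1 :> R by rewrite lef_pV2 ?posrE// ler_nat.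
  apply: le_trans (ler_distD (u n y) _ _) _.
  rewrite (splitr e) lerD// ltW//; first by rewrite distrC.
  by rewrite (lt_trans ung)// (le_lt_trans nN).
(* The shift by [j] reaches the stages whose nets take [A j] into account. *)
have net k : exists y, [/\ y \in (st (k + j).+1).1, A j y &
    forall i, (i < (k + j).+1)%N ->
    `|atan (nth g (g :: (st (k + j)).2) i y) -
      atan (nth g (g :: (st (k + j)).2) i x)| < (k + j).+1%:R^-1].
  have [_ _ + _] := stS (k + j)%N.
  move=> /(_ j x); rewrite size_st => /(_ (leq_addl _ _) Ax)[y ys [Ay yP]].
  by exists y.
have [y yP] := choice net.
have [U [UU ooU]] := ultraFilterLemma (@eventually_filter).
(* Putting [f] at index 0 gives one point [z] serving [f] and all the [u n] at once. *)
pose phi n := if n is n'.+1 then u n' else f.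
have [||z zP] := @bounded_in_ultra_cvg R X (A j) y phi U (bA j) _ _ UU.
- by move=> k; have [] := yP k.
- by case=> [|n] //; apply: Dc; exact: (uS n).1.
have atan_cvg (h : X -> R) N : (forall k, (N <= k)%N ->
    `|atan (h (y k)) - atan (h x)| < k.+1%:R^-1) ->
    atan (h (y k)) @[k --> U] --> atan (h x).
  move=> hN; apply/cvgrPdist_lt => e e0; apply: ooU.
  have [N' _ /= N'e] := near_infty_natSinv_lt (PosNum e0).
  exists (maxn N N') => // k; rewrite /= geq_max => /andP[Nk N'k].
  by rewrite distrC (lt_trans (hN k Nk))// N'e.
have yk_lt i k : (i < (k + j).+1)%N ->
    `|atan (nth g (g :: (st (k + j)).2) i (y k)) -
      atan (nth g (g :: (st (k + j)).2) i x)| < k.+1%:R^-1.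
  have [_ _ yx] := yP k => /yx /lt_le_trans; apply.
  by rewrite lef_pV2 ?posrE// ler_nat ltnS leq_addr.
have fzx : f z = g x.
  apply: atan_inj.
  have : atan (f (y k)) @[k --> U] --> atan (f z).
    by apply: (continuous_cvg _ (@continuous_atan R _)); exact: (zP 0%N).
  have -> : (fun k => atan (f (y k))) = (fun k => atan (g (y k))).
    by apply/funext => k; rewrite (fg (k + j).+1)//; have [] := yP k.
  move=> /(cvg_unique (@Rhausdorff R)); apply; apply: (atan_cvg g 0%N) => k _.
  exact: (yk_lt 0%N).
have uzx i : u i z = u i x.
  apply: atan_inj.
  have : atan (u i (y k)) @[k --> U] --> atan (u i z).
    by apply: (continuous_cvg _ (@continuous_atan R _)); exact: (zP i.+1).
  move=> /(cvg_unique (@Rhausdorff R)); apply; apply: (atan_cvg (u i) i.+1) => k ik.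
  have ikj : (i < k + j)%N by rewrite ltn_addr.
  by have := yk_lt i.+1 k ikj; rewrite /= nth_st.
rewrite -fzx; apply: eq_of_close => e e0.
have e20 : 0 < e / 2 by rewrite divr_gt0.
have [n [_ unx unz]] := uf x z (e / 2) 0%N e20.
move: unx unz; rewrite uzx !ltr_norml => /andP[? ?] /andP[? ?].
by rewrite ler_norml; apply/andP; split; lra.
Qed.

End interpolating_sequence.

(** * The embedding into bounded functions *)

Section weighted_atan.
Context {R : realType} {X : topologicalType}.
Variable A : nat -> set X.
Implicit Types (f g : X -> R).

(** The injective [atan] makes any [f] bounded; the weights confine the coordinates exceeding a
    given positive number to finitely many [A n]. *)
Let weighted_atan_fun f : nat * X -> R^o :=
  fun i => if i.2 \in A i.1 then atan (f i.2) / i.1.+1%:R else 0.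

Let weighted_atan_bounded f : weighted_atan_fun f \in bounded_fun_pred R _.
Proof.
apply/bounded_fun_predP; exists 2 => -[n x]; rewrite /weighted_atan_fun /=.
case: ifP => _; last by rewrite normr0.
rewrite normrM normfV [`|_.+1%:R|]ger0_norm// ler_pdivrMr//.
by rewrite (le_trans (normr_atan_le2 _))// ler_peMr// ler1n.
Qed.

Definition weighted_atan f : bounded_fun R (nat * X) :=
  BoundedFun (weighted_atan_bounded f).

Lemma weighted_atanBE f g n x : (weighted_atan f - weighted_atan g) (n, x) =
  if x \in A n then (atan (f x) - atan (g x)) / n.+1%:R else 0.
Proof.
have -> : (weighted_atan f - weighted_atan g) (n, x) =
  weighted_atan f (n, x) - weighted_atan g (n, x) by [].
rewrite /= /weighted_atan_fun /=.
by case: ifP => _; rewrite ?mulrBl ?subrr.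
Qed.

Lemma eq_weighted_atan f g : weighted_atan f = weighted_atan g ->
  forall x, (\bigcup_n A n) x -> f x = g x.
Proof.
move=> fg x [n _ /mem_set Anx]; apply: atan_inj.
have : weighted_atan f (n, x) = weighted_atan g (n, x) by rewrite fg.
rewrite /= /weighted_atan_fun /= Anx => /mulIf; apply.
by rewrite invr_eq0 pnatr_eq0.
Qed.

Hypothesis A_mono : forall m n, (m <= n)%N -> A m `<=` A n.
Hypothesis bA : forall n, bounded_in R (A n).

(* Otherwise, the sets where [weighted_atan (u n) - weighted_atan g] is not
   small, for the sequence [u] of [interpolating_sequence], have variation
   bounded below, so that infinitely many of them have the finite intersection
   property; a limit of points of these intersections separates [g] from a
   cluster point of [u]. *)
Lemma weighted_atan_weak_adherent (D : set (X -> R)) g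
    (phi : {linear bounded_fun R (nat * X) -> R^o}) (e : R) :
    (forall f, D f -> continuous f) ->
    (forall u : nat -> X -> R, (forall n, D (u n)) ->
      exists2 f, continuous f & pairwise_cluster u f) ->
    adherent_on D (\bigcup_n A n) g ->
    continuous (phi : bounded_fun R (nat * X) -> R) -> 0 < e ->
  exists2 f, D f & `|phi (weighted_atan f) - phi (weighted_atan g)| <= e.
Proof.
move=> Dc Drcc Dg phic e0; apply: contrapT => nD.
have {}nD f : D f -> e < `|phi (weighted_atan f) - phi (weighted_atan g)|.
  by move=> Df; rewrite ltNge; apply/negP => fe; apply: nD; exists f.
have [u [Du uP]] := interpolating_sequence bA Dc Dg.
pose v n := weighted_atan (u n) - weighted_atan g.
have phiv n : e < `|phi (v n)| by rewrite linearB nD.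
have [C [C0 phiC]] : exists C : R, 0 < C /\ forall w, `|phi w| <= C * `|w|.
  have /linear_boundedP := (linear_bounded_continuous phi).2 phic.
  move=> phiC; near (+oo : set_system R) => C; exists C; split; first by [].
  by near: C.
(* Off [B n] the contribution to [phi (v n)] is at most [C * eta = e / 2]. On [B n], where [v n] is
   at most 4, it exceeds the other [e / 2], whence a variation of at least [e / 8]. *)
pose eta := e / 2 / C.
have eta0 : 0 < eta by rewrite !divr_gt0.
have atanB_le4 (a b : R) : `|atan a - atan b| <= 4.
  rewrite (le_trans (ler_normB _ _))//.
  by have := normr_atan_le2 a; have := normr_atan_le2 b; lra.
have v_le n m x : `|v n (m, x)| <= 4 / m.+1%:R.
  rewrite /v weighted_atanBE; case: ifP => _; last by rewrite normr0 divr_ge0.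
  by rewrite normrM normfV [`|_.+1%:R|]ger0_norm// ler_pM2r ?invr_gt0.
have v_le4 n i : `|v n i| <= 4.
  case: i => m x; rewrite (le_trans (v_le n m x))// ler_pdivrMr//.
  by rewrite ler_peMr// ler1n.
pose B n := [set i | eta < `|v n i|].
have varB n : e / 8 <= functional_variation phi (B n).
  have := @le_functional_variation R _ phi C phiC (ltW C0) (v n) (B n) 4 eta.
  have -> : C * eta = e / 2 by rewrite /eta mulrCA divff ?mulr1// gt_eqF.
  move=> /(_ _ (v_le4 n) _ (ltW eta0)) vB.
  have {}vB : `|phi (v n)| <= 4 * functional_variation phi (B n) + e / 2.
    by apply: vB => // i /negP; rewrite -leNgt.
  have := phiv n; lra.
have e8 : 0 < e / 8 by rewrite divr_gt0.
have [s [s_ge sB]] := finitely_additive_intersections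
  (functional_variation_ge0 phiC (ltW C0)) (functional_variation_le phiC (ltW C0))
  (functional_variationU phiC (ltW C0)) e8 varB.
have [i iB] := choice sB.
(* A value above [eta] at [(m, x)] forces [m + 1 < 4 / eta], so all the points fall into the single
   bounded set [A J]. *)
pose J := Num.trunc (4 / eta).
have xA k : A (J) (i k).2.
  have : eta < `|v (s 0%N) (i k)| := iB k 0%N (leq0n k).
  case: (i k) => m x vmx.
  have Amx : x \in A m.
    move: vmx; rewrite /v weighted_atanBE; case: ifP => // _.
    by rewrite normr0 ltNge (ltW eta0).
  apply: (A_mono _ (set_mem Amx)).
  rewrite truncn_ge_nat; last by apply: divr_ge0 => //; exact: ltW.
  have := lt_le_trans vmx (v_le _ m x).
  rewrite ltr_pdivlMr// mulrC -ltr_pdivlMr// => /ltW; apply: le_trans.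
  by rewrite ler_nat.
have atan_gt j k : (j <= k)%N ->
    eta < `|atan (u (s j) (i k).2) - atan (g (i k).2)|.
  move=> jk; have : eta < `|v (s j) (i k)| := iB k j jk.
  case: (i k) => m x /lt_le_trans.
  apply; rewrite /v weighted_atanBE; case: ifP => _; last by rewrite normr0.
  rewrite normrM normfV [`|_.+1%:R|]ger0_norm// ler_pdivrMr//.
  by rewrite ler_peMr// ler1n.
have [f fc fu] := Drcc _ (fun n => Du (s n)).
(* Since [n <= s n], a cluster function of the subsequence is one of [u]. *)
have fg : forall x, (\bigcup_n A n) x -> f x = g x.
  apply: uP => // x z d N d0; have [n [Nn ? ?]] := fu x z d N d0.
  by exists (s n); split => //; exact: leq_trans (s_ge n).
have [U [UU ooU]] := ultraFilterLemma eventually_filter.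
pose psi n := if n is n'.+1 then u n' else f.
have [||z zP] := @bounded_in_ultra_cvg R X (A J) (fun k => (i k).2) psi U
  (bA J) _ _ UU.
- exact: xA.
- by case=> [|n] //; apply: Dc; exact: Du.
(* For fixed [j] the gap holds at the points of all [i k] with [k >= j], hence at [z]. Holding for
   every [j], it prevents [u (s j) z] from approaching [f z]. *)
have atan_ge j : eta <= `|atan (u (s j) z) - atan (f z)|.
  have atanc n : atan (psi n (i k).2) @[k --> U] --> atan (psi n z).
    by apply: (continuous_cvg _ (@continuous_atan R _)); exact: (zP n).
  have : `|atan (u (s j) (i k).2) - atan (f (i k).2)| @[k --> U] -->
      `|atan (u (s j) z) - atan (f z)|.
    by apply: cvg_norm; apply: cvgB; [exact: (atanc (s j).+1)|exact: (atanc 0%N)].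
  apply: (closed_cvg (fun t => eta <= t)); first exact: closed_ge.
  apply: ooU; exists j => // k /= jk.
  by rewrite fg ?(ltW (atan_gt j k jk))//; exists J.
have /cvgrPdist_lt/(_ _ eta0) := @continuous_atan R (f z).
move=> /nbhs_ballP[d /= d0 dP].
have [j [_ ujz _]] := fu z z d 0%N d0.
have := dP (u (s j) z); rewrite -ball_normE /= distrC => /(_ ujz).
by rewrite ltNge distrC atan_ge.
Unshelve. all: by end_near. Qed.

End weighted_atan.

(** * Pointwise and weak topologies *)

Lemma cvg_initial (S : choiceType) (T : topologicalType) (f : S -> T)
    (F : set_system (initial_topology f)) (p : initial_topology f) :
  Filter F -> f @ F --> f p -> F --> p.
Proof.
move=> FF fF B [_ [[W Wop <-] Wp sWB]]; rewrite nbhs_filterE.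
by apply: filterS sWB _; apply: fF; exact: open_nbhs_nbhs.
Qed.

Lemma cvg_ptws (I : Type) (V : topologicalType) (F : set_system {ptws I -> V})
    (f : {ptws I -> V}) :
  Filter F -> (forall i, h i @[h --> F] --> f i) -> F --> f.
Proof.
move=> FF Ff; apply/cvg_sup => i.
exact: (@cvg_initial _ _ (fun h : I -> V => h i)).
Qed.

Lemma ptws_eval_continuous (I : Type) (V : topologicalType) (i : I) :
  continuous (fun f : {ptws I -> V} => f i).
Proof.
move=> f B fB; have /cvg_sup/(_ i) ff : nbhs f --> f by [].
exact: (ff _ (@initial_continuous _ _ (fun h : I -> V => h i) f B fB)).
Qed.

Lemma sub_eval_continuous (I : Type) (V : topologicalType)
    (S : set {ptws I -> V}) (i : I) :
  continuous (fun f : S => (\val f : I -> V) i).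
Proof.
move=> f; apply: (@continuous_comp S {ptws I -> V} V \val (fun h => h i)).
  exact: initial_continuous.
exact: ptws_eval_continuous.
Qed.

Lemma separating_hausdorff (R : realType) (T : topologicalType) :
    (forall p q : T, (forall k : T -> R, continuous k -> k p = k q) -> p = q) ->
  hausdorff_space T.
Proof.
move=> sepT p q pq; apply: sepT => k kc; apply: (@Rhausdorff R) => B C kB kC.
have [t [Bt Ct]] := pq _ _ (kc p _ kB) (kc q _ kC).
by exists (k t).
Qed.

Lemma compact_hausdorff_inverse_continuous (S T : topologicalType)
    (f : S -> T) (g : T -> S) :
    compact [set: S] -> hausdorff_space T -> continuous f ->
    cancel f g -> cancel g f ->
  continuous g.
Proof.
move=> cS hT fc fK gK; apply/continuousP => B oB.
have cBc : compact (f @` ~` B).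
  apply: continuous_compact; first exact: continuous_subspaceT.
  by apply: subclosed_compact cS _ => //; exact: open_closedC.
have -> : g @^-1` B = ~` (f @` ~` B).
  apply/seteqP; split=> [t Bt [s nBs st]|t nt /=].
    by apply: nBs; rewrite -(fK s) st.
  by apply: contrapT => nB; apply: nt; exists (g t).
by apply: closed_openC; exact: compact_closed.
Qed.

Lemma continuous_eq_closure (R : realType) (X : topologicalType)
    (f h : X -> R) (Q : set X) : continuous f -> continuous h ->
  (forall x, Q x -> f x = h x) -> forall x, closure Q x -> f x = h x.
Proof.
move=> fc hc fh x Qx.
have cl : closed ((fun y => f y - h y) @^-1` [set r | r = 0]).
  by apply: closed_comp => [y _|]; [exact: cvgB (fc y) (hc y)|exact: closed_eq].
have Qsub : Q `<=` (fun y => f y - h y) @^-1` [set r | r = 0].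
  by move=> y Qy /=; rewrite fh// subrr.
have := closure_subset Qsub Qx; rewrite -(closure_id _).1// => /eqP.
by rewrite subr_eq0 => /eqP.
Qed.

Section bounded_fun_evaluation.
Context {R : realType} {I : Type}.

Definition bounded_fun_eval (i : I) (u : bounded_fun R I) : R^o := u i.

Let bounded_fun_eval_linear i : linear (bounded_fun_eval i).
Proof. by []. Qed.

HB.instance Definition _ i :=
  GRing.isLinear.Build R (bounded_fun R I) R^o _ (bounded_fun_eval i)
    (bounded_fun_eval_linear i).

Lemma bounded_fun_eval_continuous i :
  continuous (bounded_fun_eval i : bounded_fun R I -> R).
Proof.
move=> u; apply/(@cvgrPdist_le R R^o _ (nbhs u)) => e e0.
have /cvgrPdist_le/(_ _ e0) : id v @[v --> u] --> u by exact: cvg_id.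
by apply: filterS => v; apply: le_trans; exact: (sup_norm_ge (u - v) i).
Qed.

(** The coordinate evaluations are continuous functionals and separate points. *)
Lemma weak_bounded_fun_hausdorff (S : set (weak_space (bounded_fun R I))) :
  hausdorff_space S.
Proof.
apply: (@separating_hausdorff R) => p q pq.
apply/val_inj/bounded_fun_ext => i.
pose ev : cont_dual (bounded_fun R I) :=
  exist _ (bounded_fun_eval i : {linear bounded_fun R I -> R^o})
    (@bounded_fun_eval_continuous i).
apply: (pq (fun s => cont_dual_eval (\val s) ev)) => s.
apply: (@continuous_comp _ _ _ (\val : S -> weak_space (bounded_fun R I))
  (fun w => cont_dual_eval w ev)).
  exact: initial_continuous.
apply: (@continuous_comp _ _ _
  (@cont_dual_eval R (bounded_fun R I) : weak_space (bounded_fun R I) -> _)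
  (fun h : {ptws cont_dual (bounded_fun R I) -> R} => h ev)).
  exact: initial_continuous.
exact: ptws_eval_continuous.
Qed.

End bounded_fun_evaluation.

(** * The closure of the restrictions *)

Section bounded_sets.
Context {R : realType} {X : topologicalType}.
Implicit Types A B : set X.

Lemma bounded_in1 (x : X) : bounded_in R [set x].
Proof.
move=> f _; exists `|f x|; split; first exact: num_real.
by move=> M /ltW fM _ ->.
Qed.

Lemma bounded_inU A B : bounded_in R A -> bounded_in R B ->
  bounded_in R (A `|` B).
Proof.
move=> bA bB f fc; have := bA f fc; have := bB f fc; apply: filterS2.
by move=> M fB fA x [/fA|/fB].
Qed.

Lemma sigma_bounded_mono (P : set X) : sigma_bounded R P ->
  exists A : nat -> set X, [/\ forall n, bounded_in R (A n),
    (forall m n, (m <= n)%N -> A m `<=` A n) & P = \bigcup_n A n].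
Proof.
move=> [B [bB ->]]; exists (fun n => \bigcup_(i in [set i | (i <= n)%N]) B i).
split=> [n|m n mn x [i /= im Bx]|].
- elim: n => [|n ih].
    rewrite (_ : [set i | _] = [set 0%N]) ?bigcup_set1//.
    by apply/seteqP; split=> i /=; rewrite leqn0 => /eqP.
  rewrite (_ : [set i | (i <= n.+1)%N] = [set i | (i <= n)%N] `|` [set n.+1]).
    by rewrite bigcup_setU bigcup_set1; exact: bounded_inU.
  apply/seteqP; split=> i /=; rewrite [(i <= n.+1)%N]leq_eqVlt ltnS.
    by move=> /orP[/eqP|]; [right|left].
  by case=> ->; rewrite ?orbT ?eqxx.
- by exists i => //=; exact: leq_trans mn.
- apply/seteqP; split=> x [n _ Bx]; first by exists n => //; exists n => /=.
  by case: Bx => i _ Bx; exists i.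
Qed.

End bounded_sets.

Lemma adherent_on_sub (R : realType) (X : choiceType) (D : set (X -> R))
    (P Q : set X) g : P `<=` Q -> adherent_on D Q g -> adherent_on D P g.
Proof. by move=> PQ Dg s e sP; apply: Dg => x /sP/PQ. Qed.

(* The functions obtained from [interpolating_sequence] for [P] and for
   [P `|` [set y]] agree on [P], hence at [y]. *)
Lemma adherent_continuous (R : realType) (X : topologicalType)
    (P Y : set X) (D : set (X -> R)) (g : X -> R) :
    sigma_bounded R P -> P `<=` Y -> Y `<=` closure P ->
    (forall f, D f -> continuous f) ->
    (forall u : nat -> X -> R, (forall n, D (u n)) ->
      exists2 f, continuous f & pairwise_cluster u f) ->
    adherent_on D Y g ->
  exists2 f, continuous f & forall y, Y y -> f y = g y.
Proof.
move=> [A [bA PE]] PY YP Dc Drcc Dg.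
have interp (B : nat -> set X) : (forall n, bounded_in R (B n)) ->
    \bigcup_n B n `<=` Y ->
    exists2 f, continuous f & forall x, (\bigcup_n B n) x -> f x = g x.
  move=> bB BY.
  have [u [Du uP]] := interpolating_sequence bB Dc (adherent_on_sub BY Dg).
  by have [f fc fu] := Drcc u Du; exists f => //; exact: uP.
have [|f fc fg] := interp A bA; first by rewrite -PE.
exists f => // y Yy.
have [||h hc hg] := interp (fun n => A n `|` [set y]).
- by move=> n; apply: bounded_inU => //; exact: bounded_in1.
- by move=> x [n _ [Ax|->//]]; apply: PY; rewrite PE; exists n.
have <- : h y = g y by apply: hg; exists 0%N => //; right.
apply: (continuous_eq_closure fc hc) (YP y Yy) => x Px.
by rewrite fg -?PE// hg//; move: Px; rewrite PE => -[n _ Ax]; exists n => //; left.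
Qed.

Lemma cluster_pairwise (R : realType) (X : topologicalType)
    (w : nat -> Cp R X) (p : Cp R X) :
  cluster (w @ \oo) p ->
  pairwise_cluster (fun n => \val (w n) : X -> R) (\val p : X -> R).
Proof.
move=> wp x z e N e0.
have wN : (w @ \oo) [set w n | n in [set n | (N <= n)%N]].
  by exists N => // n /= Nn; exists n.
have near_p t : \forall q \near p, `|(\val q : X -> R) t - (\val p : X -> R) t| < e.
  have /cvgrPdist_lt/(_ _ e0) := @sub_eval_continuous X R (Cp R X) t p.
  by apply: filterS => q; rewrite distrC.
have := wp _ _ wN (filterI (near_p x) (near_p z)).
by move=> [_ [[n Nn <-] [? ?]]]; exists n.
Qed.

(** A sequence in [D] with [|u n x| > n] could not cluster at [x]. *)
Lemma pairwise_cluster_bounded (R : realType) (X : Type) (D : set (X -> R)) x :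
    (forall u : nat -> X -> R, (forall n, D (u n)) ->
      exists f, pairwise_cluster u f) ->
  exists M : R, forall f, D f -> `|f x| <= M.
Proof.
move=> Drcc; apply: contrapT => nM.
have large n : exists f, D f /\ n%:R < `|f x|.
  apply: contrapT => nf; apply: nM; exists n%:R => f Df.
  by rewrite leNgt; apply/negP => fn; apply: nf; exists f.
have [u uP] := choice large.
have [f uf] := Drcc u (fun n => (uP n).1).
have [n [Nn unf _]] := uf x x 1 (Num.trunc (`|f x| + 1)).+1 ltr01.
have := (uP n).2; have := truncnS_gt (`|f x| + 1).
have : (Num.trunc (`|f x| + 1)).+1%:R <= n%:R :> R by rewrite ler_nat.
have : `|u n x| <= `|u n x - f x| + `|f x|.
  by rewrite -{1}(subrK (f x) (u n x)) ler_normD.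
by move: unf; lra.
Qed.

Lemma near_eval_close (R : realType) (I : choiceType) (S : set {ptws I -> R})
    (q : S) (g : I -> R) (s : seq I) (d : R) :
    (forall i, i \in s -> `|(\val q : I -> R) i - g i| < d) ->
  \forall q' \near q, forall i, i \in s -> `|(\val q' : I -> R) i - g i| < d.
Proof.
elim: s => [|i s IH] qg; first by apply: (@nearW _ (nbhs q)) => q' i; rewrite in_nil.
have near_s := IH (fun j js => qg j (mem_behead (s := i :: s) js)).
have near_i : \forall q' \near q, `|(\val q' : I -> R) i - g i| < d.
  have /cvgrPdist_lt := @sub_eval_continuous I R S i q.
  have di : 0 < d - `|(\val q : I -> R) i - g i| by rewrite subr_gt0 qg ?mem_head.
  move=> /(_ _ di); apply: filterS => q' q'i.
  apply: le_lt_trans (ler_distD ((\val q : I -> R) i) _ _) _.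
  by rewrite -ltrBrDr distrC.
by apply: filterS2 near_i near_s => q' q'i q's j; rewrite inE => /orP[/eqP->|/q's].
Qed.

Section closure_of_restrictions.
Context {R : realType} {X : topologicalType} {Y : set X} {Z : set (Cp R X)}.

(** The list [t] allows the approximants of [f] to be kept close to another function [g] as well;
    continuity of the embedding relies on this. *)
Lemma restr_adherent (q : Cp_rel R Y) (f g : X -> R) (t : seq X) (d : R) :
    closure (@restr_map R X Y @` Z) q ->
    (forall y : Y, f (\val y) = (\val q : Y -> R) y) ->
    (forall x, x \in t -> Y x) -> (forall x, x \in t -> `|f x - g x| < d) ->
  adherent_on [set h | (exists2 w, Z w & h = \val w) /\
    forall x, x \in t -> `|h x - g x| < d] Y f.
Proof.
move=> qZ fq tY tg s e sY e0.
(* Here [pmap insub] turns a list of points of [X] into a list of points of the subtype [Y]. *)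
have near_s : \forall q' \near q, forall y : Y, y \in pmap insub s ->
    `|(\val q' : Y -> R) y - f (\val y)| < e.
  by apply: near_eval_close => y _; rewrite fq subrr normr0.
have near_t : \forall q' \near q, forall y : Y, y \in pmap insub t ->
    `|(\val q' : Y -> R) y - g (\val y)| < d.
  by apply: near_eval_close => y; rewrite -fq mem_pmap_sub; exact: tg.
have [_ [[w Zw <-] [ws wt]]] := qZ _ (filterI near_s near_t).
exists (\val w); first split.
- by exists w.
- move=> x xt; have := wt (SigSub (mem_set (tY x xt))).
  by rewrite mem_pmap_sub; apply.
- move=> x xs; have := ws (SigSub (mem_set (sY x xs))).
  by rewrite mem_pmap_sub; apply.
Qed.

End closure_of_restrictions.

Section closure_eberlein.
Context {R : realType} {X : topologicalType} {P Y : set X} {Z : set (Cp R X)}.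
Hypothesis sbP : sigma_bounded R P.
Hypothesis PY : P `<=` Y.
Hypothesis YP : Y `<=` closure P.
Hypothesis rccZ : relatively_countably_compact Z.

Let D : set (X -> R) := [set h | exists2 w, Z w & h = \val w].

Let D_continuous f : D f -> continuous f.
Proof. by move=> [w _ ->]; exact: (set_valP w). Qed.

Let D_cluster (u : nat -> X -> R) : (forall n, D (u n)) ->
  exists2 f, continuous f & pairwise_cluster u f.
Proof.
move=> Du; have Dw n : exists w, Z w /\ u n = \val w by have [w] := Du n; exists w.
have [w wP] := choice Dw.
have [p /cluster_pairwise wp] := rccZ (fun n => (wP n).1).
exists (\val p); first exact: (set_valP p).
by rewrite (_ : u = fun n => \val (w n))//; apply/funext => n; exact: (wP n).2.
Qed.

Let K : set (Cp_rel R Y) := closure (@restr_map R X Y @` Z).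

(** Elements of [K] live on [Y], while the preceding results concern functions on [X]; a continuous
    extension is chosen for each. *)
Let lift_ex (h : K) : {f : X -> R | continuous f /\
  forall y : Y, f (\val y) = (\val (\val h) : Y -> R) y}.
Proof.
apply: cid; have [f fc fE] : Cp_rel R Y (\val (\val h)) := set_valP (\val h).
by exists f; split=> // y; rewrite -fE.
Qed.

Let lift (h : K) : X -> R := sval (lift_ex h).

Let lift_continuous h : continuous (lift h).
Proof. by rewrite /lift; case: lift_ex => f []. Qed.

Let liftE h (y : Y) : lift h (\val y) = (\val (\val h) : Y -> R) y.
Proof. by rewrite /lift; case: lift_ex => f []. Qed.

Let lift_adherent_near h (t : seq X) (g : X -> R) (d : R) :
    (forall x, x \in t -> Y x) ->
    (forall x, x \in t -> `|lift h x - g x| < d) ->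
  adherent_on [set f | D f /\ forall x, x \in t -> `|f x - g x| < d] Y (lift h).
Proof. exact: (restr_adherent (set_valP h) (liftE h)). Qed.

Let lift_adherent h : adherent_on D Y (lift h).
Proof.
move=> s e sY e0.
have [||f [Df _] fh] := @lift_adherent_near h [::] (lift h) 1 _ _ s e sY e0 => //.
by exists f.
Qed.

Let eval_bounded (y : Y) :
  exists M : R, forall h : K, `|(\val (\val h) : Y -> R) y| <= M.
Proof.
have [|M DM] := @pairwise_cluster_bounded R X D (\val y).
  by move=> u Du; have [f _ uf] := D_cluster Du; exists f.
exists (M + 1) => h.
have [|f /DM fM fh] := @lift_adherent h [:: \val y] 1 _ ltr01.
  by move=> x; rewrite inE => /eqP->; exact: set_valP y.
have := fh _ (mem_head _ _); rewrite liftE distrC => /ltW {}fh.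
rewrite -[(\val (\val h) : Y -> R) y](subrK (f (\val y))) (le_trans (ler_normD _ _))//.
by rewrite addrC lerD.
Qed.

(** An ultrafilter on [K] converges pointwise because evaluations are bounded. The limit is adherent
    to [D] on [Y], so [adherent_continuous] places it in [Cp_rel R Y]. *)
Lemma closure_restr_compact : compact [set: K].
Proof.
rewrite compact_ultra => U UU _.
have evU y : cvg ((\val (\val h) : Y -> R) y @[h --> U]).
  have [M KM] := eval_bounded y.
  apply: (@ultra_bounded_cvg _ _ _ _ (- M) M); apply: nearW => h.
  by rewrite -ler_norml.
pose l (y : Y) := lim ((\val (\val h) : Y -> R) y @[h --> U]).
(* The value 0 off [Y] is arbitrary: adherence is tested on [Y] only. *)
pose g x := if insub x is Some y then l y else 0.
have gE (y : Y) : g (\val y) = l y by rewrite /g valK.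
have Dg : adherent_on D Y g.
  move=> s e sY e0; have e20 : 0 < e / 2 by rewrite divr_gt0.
  have Ug : \forall h \near U, forall x, x \in s -> `|lift h x - g x| < e / 2.
    elim: s sY => [|x s IH] sY; first by apply: nearW => h x; rewrite in_nil.
    have {}IH := IH (fun y ys => sY y (mem_behead (s := x :: s) ys)).
    pose y : Y := SigSub (mem_set (sY x (mem_head x s))).
    have /cvgrPdist_lt/(_ _ e20) := evU y.
    apply: filterS2 IH => h hs hy z; rewrite inE => /orP[/eqP->|/hs//].
    by rewrite -[x]/(\val y) liftE gE distrC.
  have [h hg] := filter_ex Ug.
  have [f Df fh] := lift_adherent h sY e20.
  exists f => // x xs; apply: le_lt_trans (ler_distD (lift h x) _ _) _.
  by rewrite (splitr e) ltrD// ?fh ?hg.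
have [f fc fg] := adherent_continuous sbP PY YP D_continuous D_cluster Dg.
pose q : Cp_rel R Y := SigSub (mem_set (imageP (sigL Y) (fc : Cp R X f))).
have Uq : \val h @[h --> U] --> q.
  apply: cvg_initial; apply: cvg_ptws => y.
  have fl : f (\val y) = l y by rewrite fg ?gE//; exact: (set_valP y).
  have : (\val (\val h) : Y -> R) y @[h --> U] --> l y := evU y.
  by rewrite -fl.
have Kq : K q.
  apply: closed_closure => B qB.
  have UB : U [set h | B (\val h)] := Uq B qB.
  have [h hB] := filter_ex UB.
  by exists (\val h); split => //; exact: (set_valP h).
exists (SigSub (mem_set Kq)); split => //.
by apply: cvg_initial.
Qed.

Lemma closure_restr_eberlein : eberlein_compactum R K.
Proof.
split; first exact: closure_restr_compact.
have [A [bA A_mono PE]] := sigma_bounded_mono sbP.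
pose T (h : K) : weak_space (bounded_fun R (nat * X)) := weighted_atan A (lift h).
have T_inj : injective T.
  move=> h h' hh'; apply/val_inj/val_inj/funext => y.
  (* The two lifts agree on [P], hence on its closure, which contains [Y]. *)
  rewrite -!liftE; apply: (@continuous_eq_closure R X _ _ P) (YP (set_valP y)) => //.
  by move=> x; rewrite PE; exact: eq_weighted_atan hh' x.
have Tc : continuous T.
  apply: continuous_comp_initial => h.
  have FF : Filter (nbhs h) := nbhs_filter h.
  apply: cvg_ptws => phi; apply/(@cvgrPdist_le R R^o _ (nbhs h)) => e e0.
  have e20 : 0 < e / 2 by rewrite divr_gt0.
  (* If no such [s] and [d] existed, the functions of [D] violating the estimate would still be
     adherent to [lift h], against [weighted_atan_weak_adherent]. *)
  have [s [d [sP d0 sd]]] : exists (s : seq X) (d : R),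
      [/\ forall x, x \in s -> P x, 0 < d & forall f, D f ->
        (forall x, x \in s -> `|f x - lift h x| < d) ->
        `|sval phi (weighted_atan A f) - sval phi (T h)| <= e / 2].
    apply: contrapT => nsd.
    pose D' := [set f | D f /\
      e / 2 < `|sval phi (weighted_atan A f) - sval phi (T h)|].
    have D'h : adherent_on D' (\bigcup_n A n) (lift h).
      move=> s d sA d0; apply: contrapT => nf; apply: nsd; exists s, d.
      split=> // [x /sA|f Df fh]; first by rewrite PE.
      by rewrite leNgt; apply/negP => fe; apply: nf; exists f.
    have [| |f [_ fe]] :=
      weighted_atan_weak_adherent A_mono bA _ _ D'h (svalP phi) e20.
    - by move=> f [/D_continuous].
    - by move=> u D'u; apply: D_cluster => n; have [] := D'u n.
    - by rewrite leNgt fe.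
  have near_h : \forall h' \near h, forall x, x \in s -> `|lift h' x - lift h x| < d.
    have lift0 (y : Y) : y \in pmap insub s ->
        `|(\val (\val h) : Y -> R) y - lift h (\val y)| < d.
      by rewrite liftE subrr normr0.
    have near_s : \forall h' \near h, forall y : Y, y \in pmap insub s ->
        `|(\val (\val h') : Y -> R) y - lift h (\val y)| < d :=
      @initial_continuous K (Cp_rel R Y) \val h _ (near_eval_close lift0).
    apply: filterS near_s => h' h's x xs.
    have := h's (SigSub (mem_set (PY (sP x xs)))).
    by rewrite mem_pmap_sub -liftE; apply.
  apply: filterS near_h => h' h's.
  (* For [h'] near [h], some [f] in [D] is close to [lift h] on [s] while its image under [phi] is
     within [e / 2] of that of [T h']; by [sd] it is also within [e / 2] of that of [T h]. *)
  have Ph' := lift_adherent_near (fun x xs => PY (sP x xs)) h's.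
  have [| | |f [Df fs] fh'] := weighted_atan_weak_adherent A_mono bA _ _
    (adherent_on_sub _ Ph') (svalP phi) e20.
  - by move=> f [/D_continuous].
  - by move=> u D'u; apply: D_cluster => n; have [] := D'u n.
  - by rewrite -PE.
  have fh := sd f Df fs.
  rewrite distrC (splitr e).
  apply: le_trans (ler_distD (sval phi (weighted_atan A f)) _ _) _.
  by rewrite lerD// distrC.
pose S : set (weak_space (bounded_fun R (nat * X))) := range T.
exists (bounded_fun R (nat * X)), S; split.
  by apply: continuous_compact closure_restr_compact; exact: continuous_subspaceT.
pose F (h : K) : S := SigSub (mem_set (imageT T h)).
have S_range (a : S) : exists h, T h = \val a by have [h _ hE] := set_valP a; exists h.
have [G GE] := choice S_range.
have GK : cancel G F by move=> a; apply/val_inj; exact: GE.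
have FK : cancel F G by move=> h; apply: T_inj; rewrite GE.
have Fc : continuous F by apply: continuous_comp_initial.
exists F, G; split => //.
apply: compact_hausdorff_inverse_continuous FK GK => //.
  exact: closure_restr_compact.
exact: weak_bounded_fun_hausdorff.
Qed.

End closure_eberlein.

Theorem proposition16 (R : realType) (X : topologicalType) (P Y : set X)
    (Z : set (Cp R X)) (tychX : tychonoff_space X)
    (sbP : sigma_bounded R P) (PY : P `<=` Y) (YclP : Y `<=` closure P)
    (rccZ : relatively_countably_compact Z) :
  eberlein_compactum R (closure (@restr_map R X Y @` Z)).
Proof. exact: (closure_restr_eberlein sbP PY YclP rccZ). Qed.
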